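(* Let $f : \mathbb{R}^n \to \mathbb{R}$ be a convex function which is $1$-smooth with respect to the seminorm $\|\cdot\|_B$, where $B$ is an $n\times n$ real symmetric positive semidefinite matrix with eigenvalues $\lambda_1\geq\dots\geq\lambda_n$. Let $x_0\in\mathbb{R}^n$ be such that the sublevel set $L_f(x_0) := \{x\in\mathbb{R}^n : f(x)\leq f(x_0)\}$ is bounded. For $1\le\tau\le\operatorname{Rank}(B)$ let $D_\tau := \max_{x\in L_f(x_0)}\min_{x^*\in\operatorname{Argmin} f}\|x-x^*\|_{B_\tau}$. Then for all $1\leq\tau_1<\tau_2\leq\operatorname{Rank}(B)$, $$D_{\tau_2}^2 \leq D_{\tau_1}^2 \leq R_\lambda(\tau_1,\tau_2)\, D_{\tau_2}^2, \qquad\text{where}\quad R_\lambda(\tau_1,\tau_2) := \frac{\sum_{i=\tau_1}^n\lambda_i}{\sum_{i=\tau_2}^n\lambda_i}.$$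
   Context: Notation: $\langle\cdot,\cdot\rangle$ is the standard inner product on $\mathbb{R}^n$; for a symmetric positive semidefinite matrix $B$, $\|v\|_B := \langle Bv, v\rangle^{1/2}$. $\operatorname{Argmin} f$ is the set of minimizers of $f$. A differentiable function $f:\mathbb{R}^n\to\mathbb{R}$ is $1$-smooth with respect to $\|\cdot\|_B$ if $f(y) \leq f(x) + \langle \nabla f(x), y-x\rangle + \frac12\|y-x\|_B^2$ for all $x,y\in\mathbb{R}^n$. $\tau$-coordinate approximation: if $B = Q\operatorname{Diag}(\lambda_1,\dots,\lambda_n)Q^T$ with $Q$ orthogonal, then for $1\le\tau\le\operatorname{Rank}(B)$, $B_\tau := Q\operatorname{Diag}(\lambda_1,\dots,\lambda_\tau,\lambda_\tau,\dots,\lambda_\tau)Q^T + \left(\sum_{i=\tau+1}^n\lambda_i\right) I$, where $I$ is the identity matrix. It is positive definite and does not depend on the choice of $Q$. *)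

(* Defs.v *)
From mathcomp Require Import all_boot all_order all_algebra.
From mathcomp Require Import all_classical all_reals all_analysis.
Import Order.TTheory GRing.Theory Num.Theory.
Import numFieldNormedType.Exports.

Set Implicit Arguments.
Unset Strict Implicit.
Unset Printing Implicit Defensive.

Local Open Scope classical_set_scope.
Local Open Scope ring_scope.

(* Vectors of R^n are row vectors, so the image Bv is written v *m B^T. *)
Section Vectors.
Context {R : realType} {n : nat}.
Implicit Types (x y v : 'rV[R]_n) (B : 'M[R]_n) (f : 'rV[R]_n -> R).

Definition inner x y : R := \sum_(i < n) x 0 i * y 0 i.

Definition is_psd B : Prop :=
  B^T = B /\ forall v, 0 <= inner (v *m B^T) v.

Definition seminorm B v : R := Num.sqrt (inner (v *m B^T) v).

Definition grad f x : 'rV[R]_n := \row_(i < n) 'D_(delta_mx 0 i) f x.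

Definition one_smooth B f : Prop :=
  (forall x, differentiable f x) /\
  forall x y,
    f y <= f x + inner (grad f x) (y - x) + 2^-1 * seminorm B (y - x) ^+ 2.

Definition Argmin f : set 'rV[R]_n := [set x | forall y, f x <= f y].

Definition sublevel f x0 : set 'rV[R]_n := [set x | f x <= f x0].

End Vectors.

Section CoordinateApproximation.
Context {R : realType} {n : nat}.

(* The sequence [lam] is indexed from 1: only lam 1, ..., lam n matter. *)
Definition is_sorted_spectral_decomp
    (B Q : 'M[R]_n) (lam : nat -> R) : Prop :=
  [/\ Q *m Q^T = 1%:M,
      B = Q *m diag_mx (\row_(i < n) lam i.+1) *m Q^T &
      forall i j : nat, (1 <= i)%N -> (i <= j)%N -> (j <= n)%N ->
        lam j <= lam i].

Definition coord_approx (Q : 'M[R]_n) (lam : nat -> R) (tau : nat) : 'M[R]_n :=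
  Q *m diag_mx (\row_(i < n) lam (minn i.+1 tau)) *m Q^T
  + (\sum_(tau.+1 <= i < n.+1) lam i)%:M.

Definition tail_ratio (lam : nat -> R) (tau1 tau2 : nat) : R :=
  (\sum_(tau1 <= i < n.+1) lam i) / (\sum_(tau2 <= i < n.+1) lam i).

End CoordinateApproximation.
Arguments tail_ratio {R} n lam tau1 tau2.

Section MaxMin.
Context {R : realType}.

Definition is_max (S : set R) (m : R) : Prop := S m /\ ubound S m.

Definition is_min (S : set R) (m : R) : Prop := S m /\ lbound S m.

(* D is the maximum over x in X of the minimum over y in Y of d x y; in
   particular the inner minimum is attained for every x in X. *)
Definition is_maxmin {T U : Type} (X : set T) (Y : set U) (d : T -> U -> R)
    (D : R) : Prop :=
  exists2 h : T -> R,
    (forall x, X x -> is_min [set d x y | y in Y] (h x)) &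
    is_max [set h x | x in X] D.

End MaxMin.

(* Main.v *)
Require Import Defs.
From mathcomp Require Import all_boot all_order all_algebra.
From mathcomp Require Import all_classical all_reals all_analysis.
From mathcomp Require Import lra.
Import Order.TTheory GRing.Theory Num.Theory.
Import numFieldNormedType.Exports.

Set Implicit Arguments.
Unset Strict Implicit.
Unset Printing Implicit Defensive.

Local Open Scope classical_set_scope.
Local Open Scope ring_scope.

(** All the matrices [B_tau] are diagonal in the basis [Q], so they are compared
    eigenvalue by eigenvalue: [B_tau2 <= B_tau1 <= R_lambda(tau1, tau2) B_tau2]
    in the Loewner order. The seminorms, and hence the max-min radii, compare
    accordingly. The maxima and minima exist because the sublevel set and the
    set of minimizers are compact and a minimum of continuous functions is
    upper semicontinuous. *)

(** * Existence and comparison of max-min values *)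

Lemma seq_argmax (R : realType) (T : eqType) (h : T -> R) (s : seq T) :
  s != [::] -> exists2 m, m \in s & forall x, x \in s -> h x <= h m.
Proof.
elim: s => // a s IHs _; have [->|/IHs[m ms hm]] := eqVneq s [::].
  by exists a; rewrite ?mem_head// => x; rewrite inE => /eqP ->.
have [ham|hma] := leP (h a) (h m).
  exists m; rewrite ?inE ?ms ?orbT// => x.
  by rewrite inE => /predU1P[->//|/hm].
exists a; rewrite ?mem_head// => x; rewrite inE => /predU1P[->//|/hm hxm].
exact: le_trans hxm (ltW hma).
Qed.

(* The sets [h < h x] with [x] in [X] form an open cover of [X] when no
   maximum exists; a finite subcover is contradictory. *)
Lemma usc_compact_max (R : realType) (T : ptopologicalType) (X : set T)
    (h : T -> R) :
  (forall a, open [set x | h x < a]) -> compact X -> X !=set0 ->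
  exists2 m, X m & forall x, X x -> h x <= h m.
Proof.
move=> usc cX [a Xa]; apply: contrapT => noMax.
have above x : X x -> exists2 y, X y & h x < h y.
  move=> Xx; apply: contrapT => nxy; apply: noMax; exists x => // y Xy.
  by rewrite leNgt; apply/negP => hxy; apply: nxy; exists y.
move: cX; rewrite compact_cover.
move=> /(_ _ X (fun y => [set x | h x < h y]))[] => [y _|x /above//|D DX XD].
  exact: usc.
have D0 : finmap.enum_fset D != [::].
  apply/eqP => Dnil; have [y yD _] := XD _ Xa.
  by move: (yD : y \in finmap.enum_fset D); rewrite Dnil.
have [m mD hm] := seq_argmax h D0.
have [y yD /=] := XD m (set_mem (DX _ mD)).
by rewrite ltNge hm.
Qed.

Lemma maxmin_exists (R : realType) (T U : ptopologicalType) (X : set T)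
    (Y : set U) (d : T -> U -> R) :
  compact X -> X !=set0 -> compact Y -> Y !=set0 ->
  (forall x, continuous (d x)) -> (forall y, continuous (d^~ y)) ->
  exists D, is_maxmin X Y d D.
Proof.
move=> cX X0 cY Y0 cd1 cd2.
have [p pP] : {p : T -> U & forall x, Y (p x) /\ forall y, Y y -> d x (p x) <= d x y}.
  apply: (@choice _ _ (fun x q => Y q /\ forall y, Y y -> d x q <= d x y)) => x.
  have [|c /set_mem Yc hc] := @compact_EVT_min _ _ (d x) _ Y0 cY.
    exact: continuous_subspaceT.
  by exists c; split=> // y Yy; apply: hc; rewrite inE.
pose h x := d x (p x).
have usc a : open [set x | h x < a].
  (* The minimum over [Y] is below [a] iff some [d x y] is, so this set is a union of open sets. *)
  rewrite [X in open X](_ : _ = \bigcup_(y in Y) (d^~ y @^-1` [set r | r < a])).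
    apply: bigcup_open => y _; apply: open_comp; last exact: open_lt.
    by move=> x _; exact: cd2.
  apply/seteqP; split=> x /=.
    by move=> hx; exists (p x) => //; have [] := pP x.
  by move=> [y Yy]; apply: le_lt_trans; have [_] := pP x; apply.
have [m Xm hm] := usc_compact_max usc cX X0.
exists (h m), h => [x _|]; last first.
  by split; [exists m|move=> _ [x Xx <-]; exact: hm].
have [Yp hp] := pP x.
by split; [exists (p x)|move=> _ [y Yy <-]; exact: hp].
Qed.

(** Take [x] attaining the outer maximum for [d1] and [y] attaining the inner minimum for [d2] at
    that [x]; then [D1 <= d1 x y <= c * d2 x y <= c * D2]. *)
Lemma le_maxmin (R : realType) (T U : Type) (X : set T) (Y : set U)
    (d1 d2 : T -> U -> R) (c D1 D2 : R) :
  0 <= c -> (forall x y, d1 x y <= c * d2 x y) ->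
  is_maxmin X Y d1 D1 -> is_maxmin X Y d2 D2 -> D1 <= c * D2.
Proof.
move=> c0 d12 [h1 min1 [[x Xx <-] _]] [h2 min2 [_ max2]].
have [_ lb1] := min1 x Xx; have [[y Yy d2E] _] := min2 x Xx.
apply: (@le_trans _ _ (d1 x y)); first by apply: lb1; exists y.
apply: le_trans (d12 x y) _; rewrite d2E ler_wpM2l//.
by apply: max2; exists x.
Qed.

Lemma maxmin_ge0 (R : realType) (T U : Type) (X : set T) (Y : set U)
    (d : T -> U -> R) (D : R) :
  (forall x y, 0 <= d x y) -> is_maxmin X Y d D -> 0 <= D.
Proof.
by move=> d0 [h hmin [[x Xx <-] _]]; have [[y _ <-] _] := hmin x Xx.
Qed.

Lemma continuous_seminorm (R : realType) (n : nat) (B : 'M[R]_n) :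
  continuous (seminorm B).
Proof.
move=> v; rewrite /seminorm.
apply: (@continuous_comp _ _ _ (fun v : 'rV[R]_n => inner (v *m B^T) v)
  (@Num.sqrt R)); last exact: sqrt_continuous.
have cB i : continuous (fun v : 'rV[R]_n => (v *m B^T) 0 i).
  rewrite [X in continuous X](_ : _ =
      fun v : 'rV[R]_n => \sum_j v 0 j * B^T j i); last first.
    by apply/funext => u; rewrite mxE.
  apply: continuous_big; first exact: add_continuous.
  by move=> j _ u; apply: continuousM; [exact: coord_continuous|exact: cst_continuous].
rewrite /inner; move: v; apply: continuous_big; first exact: add_continuous.
by move=> i _ v; apply: continuousM; [exact: cB|exact: coord_continuous].
Qed.

(** * Compactness of the sublevel set and of the set of minimizers *)

Lemma compact_sublevel (R : realType) (n : nat) (f : 'rV[R]_n -> R) x0 :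
  continuous f -> bounded_set (sublevel f x0) -> compact (sublevel f x0).
Proof.
move=> cf bf; apply: bounded_closed_compact => //.
exact: (proj1 (continuous_closedP f) cf _ (@closed_le _ (f x0))).
Qed.

(** A minimizer over the compact sublevel set is global, since [f] exceeds [f x0] outside that
    set. *)
Lemma Argmin_neq0 (R : realType) (n : nat) (f : 'rV[R]_n -> R) x0 :
  continuous f -> bounded_set (sublevel f x0) -> Argmin f !=set0.
Proof.
move=> cf bf; have cS := compact_sublevel cf bf.
have S0 : sublevel f x0 !=set0 by exists x0; rewrite /sublevel /=.
have [|c /set_mem Sc cmin] := @EVT_min_rV _ _ f _ S0 cS.
  exact: continuous_subspaceT.
exists c => y; have [yx0|/ltW x0y] := leP (f y) (f x0).
  by apply: cmin; rewrite inE.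
exact: le_trans Sc x0y.
Qed.

Lemma compact_Argmin (R : realType) (n : nat) (f : 'rV[R]_n -> R) x0 :
  continuous f -> bounded_set (sublevel f x0) -> compact (Argmin f).
Proof.
move=> cf bf; apply: subclosed_compact (compact_sublevel cf bf) _; last first.
  by move=> x; apply.
have [c cmin] := Argmin_neq0 cf bf.
(* The minimizers form the sublevel set at the minimal value [f c], which is closed. *)
rewrite (_ : Argmin f = f @^-1` [set r | r <= f c]).
  exact: (proj1 (continuous_closedP f) cf _ (@closed_le _ (f c))).
by apply/seteqP; split=> [x xmin|x fxc y]; [exact: xmin|exact: le_trans fxc _].
Qed.

(** * Quadratic forms diagonal in a common orthonormal basis *)

Section Spectral.
Context {R : realType} {n : nat}.
Implicit Types (d v : 'rV[R]_n) (Q : 'M[R]_n) (lam : nat -> R).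

Lemma innerE (x y : 'rV[R]_n) : inner x y = (x *m y^T) 0 0.
Proof. by rewrite mxE; apply: eq_bigr => i _; rewrite mxE. Qed.

Lemma inner_spectral Q d v :
  inner (v *m (Q *m diag_mx d *m Q^T)^T) v
  = \sum_(i < n) d 0 i * (v *m Q) 0 i ^+ 2.
Proof.
rewrite innerE !trmx_mul trmxK tr_diag_mx !mulmxA -mulmxA -trmx_mul.
rewrite mxE; apply: eq_bigr => i _.
by rewrite mul_mx_diag !mxE mulrAC mulrC expr2.
Qed.

(** The eigenvalues of B_tau in the basis [Q], with the scalar shift absorbed into the diagonal. *)
Definition approx_spectrum lam (tau : nat) : 'rV[R]_n :=
  \row_(i < n) (lam (minn i.+1 tau) + \sum_(tau.+1 <= j < n.+1) lam j).

Lemma coord_approxE Q lam tau : Q *m Q^T = 1%:M ->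
  coord_approx Q lam tau = Q *m diag_mx (approx_spectrum lam tau) *m Q^T.
Proof.
move=> QQ; rewrite /coord_approx; set c := \sum_(_ <= _ < _) _.
have -> : approx_spectrum lam tau
  = \row_(i < n) lam (minn i.+1 tau) + const_mx c.
  by apply/rowP => i; rewrite !mxE.
rewrite linearD/= mulmxDr mulmxDl diag_const_mx; congr (_ + _).
by rewrite mul_mx_scalar -scalemxAl QQ scalemx1.
Qed.

Lemma le_seminorm_spectral Q (c : R) d1 d2 v :
  0 <= c -> (forall i, 0 <= d2 0 i) -> (forall i, d1 0 i <= c * d2 0 i) ->
  seminorm (Q *m diag_mx d1 *m Q^T) v
  <= Num.sqrt c * seminorm (Q *m diag_mx d2 *m Q^T) v.
Proof.
move=> c0 d20 d12; rewrite /seminorm !inner_spectral -sqrtrM// ler_sqrt.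
  rewrite mulr_sumr; apply: ler_sum => i _.
  by rewrite [leRHS]mulrA ler_wpM2r// sqr_ge0.
by apply: mulr_ge0 => //; apply: sumr_ge0 => i _; rewrite mulr_ge0// sqr_ge0.
Qed.

(** Evaluating the form at the [i]-th column of [Q] isolates [d 0 i]. *)
Lemma psd_spectrum_ge0 Q d : Q *m Q^T = 1%:M ->
  is_psd (Q *m diag_mx d *m Q^T) -> forall i, 0 <= d 0 i.
Proof.
move=> QQ [_ psd] i; have := psd (delta_mx 0 i *m Q^T).
rewrite inner_spectral -mulmxA (mulmx1C QQ) mulmx1 (bigD1 i)//= big1.
  by rewrite !mxE !eqxx expr1n mulr1 addr0.
by move=> j ji; rewrite !mxE (negPf ji) andbF expr0n/= mulr0.
Qed.

(** For [r <= n], left multiplication by [pid_mx r], of rank [r], leaves the diagonal matrix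
    unchanged. *)
Lemma mxrank_diag_leq d (r : nat) :
  (forall i : 'I_n, (r <= i)%N -> d 0 i = 0) -> (\rank (diag_mx d) <= r)%N.
Proof.
move=> d0; have [rn|/ltnW nr] := leqP r n; last exact: leq_trans (rank_leq_row _) nr.
have -> : diag_mx d = pid_mx r *m diag_mx d.
  rewrite mul_mx_diag; apply/matrixP => i j; rewrite !mxE.
  have [<-|ij] := eqVneq i j; last first.
    by rewrite mulr0n (_ : (i == j :> nat) = false) ?mul0r//; apply/negbTE.
  by rewrite eqxx mulr1n; case: (ltnP i r) => [_|/d0 ->]; rewrite ?mul1r ?mulr0.
by rewrite (leq_trans (mxrankM_maxl _ _))// rank_pid_mx.
Qed.

End Spectral.

(** * Eigenvalue inequalities between B_tau1 and B_tau2 *)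

Section SpectrumComparison.
Context {R : realType} {n : nat}.
Variables (B Q : 'M[R]_n) (lam : nat -> R).
Hypotheses (psdB : is_psd B) (specB : is_sorted_spectral_decomp B Q lam).

Let QQ : Q *m Q^T = 1%:M. Proof. by case: specB. Qed.

Lemma spectrum_ge0 k : (1 <= k <= n)%N -> 0 <= lam k.
Proof.
case: specB => _ BE _; case: k => // k kn.
have := @psd_spectrum_ge0 _ _ Q (\row_(i < n) lam i.+1) QQ.
by rewrite -BE => /(_ psdB (Ordinal kn)); rewrite mxE.
Qed.

(** If [lam k] were zero, monotonicity and nonnegativity would kill all later eigenvalues, forcing
    the rank below [k]. *)
Lemma spectrum_gt0 k : (1 <= k <= \rank B)%N -> 0 < lam k.
Proof.
move=> /andP[k1 kB]; have kn : (k <= n)%N := leq_trans kB (rank_leq_row _).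
have [_ BE sorted] := specB.
rewrite lt_neqAle spectrum_ge0 ?k1// andbT; apply/negP => /eqP lk0.
have : (\rank B <= k.-1)%N.
  rewrite BE (leq_trans (mxrankM_maxl _ _))// (leq_trans (mxrankM_maxr _ _))//.
  (* Diagonal entry [i] is [lam i.+1], so the zeros start at index [k.-1]. *)
  apply: mxrank_diag_leq => i ki; rewrite mxE; apply/le_anti.
  rewrite spectrum_ge0 ?ltn_ord// andbT lk0.
  by apply: sorted => //; rewrite -(ltn_predK k1).
by move=> /(leq_trans kB); rewrite -{1}(prednK k1) ltnn.
Qed.

Lemma tail_ge0 k : (1 <= k)%N -> 0 <= \sum_(k <= i < n.+1) lam i.
Proof.
move=> k1; rewrite big_nat sumr_ge0// => i /andP[ki il].
by rewrite spectrum_ge0// (leq_trans k1 ki).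
Qed.

Lemma le_tail k l : (1 <= k)%N -> (k <= l <= n.+1)%N ->
  \sum_(l <= i < n.+1) lam i <= \sum_(k <= i < n.+1) lam i.
Proof.
move=> k1 /andP[kl ln]; rewrite (big_cat_nat kl ln)/= lerDr.
rewrite big_nat sumr_ge0// => i /andP[ki il].
by rewrite spectrum_ge0// (leq_trans k1 ki) -ltnS (leq_trans il).
Qed.

Variables tau1 tau2 : nat.
Hypotheses (tau1_gt0 : (1 <= tau1)%N) (tau12 : (tau1 < tau2)%N).
Hypothesis tau2B : (tau2 <= \rank B)%N.

Let tau2n : (tau2 <= n)%N := leq_trans tau2B (rank_leq_row _).
Let sorted i j : (1 <= i)%N -> (i <= j)%N -> (j <= n)%N -> lam j <= lam i.
Proof. by case: specB => _ _; apply. Qed.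

Lemma approx_spectrum_ge0 tau (i : 'I_n) : (1 <= tau)%N ->
  0 <= approx_spectrum lam tau 0 i.
Proof.
move=> t1; rewrite mxE addr_ge0 ?tail_ge0// spectrum_ge0//.
by rewrite leq_min t1/= geq_min ltn_ord.
Qed.

(** Raising tau raises the index [minn i.+1 tau], which lowers [lam], and removes nonnegative terms
    from the tail. *)
Lemma le_approx_spectrum (i : 'I_n) :
  approx_spectrum lam tau2 0 i <= approx_spectrum lam tau1 0 i.
Proof.
rewrite !mxE lerD ?le_tail//; last by rewrite ltnS (ltnW tau12).
apply: sorted; rewrite ?leq_min ?tau1_gt0 ?geq_min ?ltn_ord//.
by rewrite leqnn/= (ltnW tau12) orbT.
Qed.

(** The leading term [lam tau2] is positive because [tau2 <= \rank B]. This sum is the denominator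
    of the ratio. *)
Lemma tail_gt0 : 0 < \sum_(tau2 <= i < n.+1) lam i.
Proof.
rewrite big_ltn ?ltnS// ltr_wpDr ?tail_ge0//.
by rewrite spectrum_gt0// tau2B (leq_trans tau1_gt0 (ltnW tau12)).
Qed.

Lemma tail_ratio_ge0 : 0 <= tail_ratio n lam tau1 tau2.
Proof. by rewrite divr_ge0 ?(ltW tail_gt0)// tail_ge0. Qed.

(** Write a, b for [lam tau1], [lam tau2] and S, T for the sums of the eigenvalues after [tau1],
    [tau2]. The ratio is (a + S) / (b + T), so clearing the positive denominator leaves a polynomial
    inequality. *)
Lemma approx_spectrum_le_ratio (i : 'I_n) :
  approx_spectrum lam tau1 0 i
  <= tail_ratio n lam tau1 tau2 * approx_spectrum lam tau2 0 i.
Proof.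
have tau1n := leq_trans (ltnW tau12) tau2n.
have tau2_gt0 := leq_trans tau1_gt0 (ltnW tau12).
rewrite /tail_ratio mulrAC ler_pdivlMr ?tail_gt0// !mxE.
rewrite (@big_ltn _ _ _ tau1) ?ltnS// (@big_ltn _ _ _ tau2) ?ltnS//.
have := @le_tail tau1.+1 tau2.+1 isT; rewrite !ltnS (ltnW tau12) tau2n => /(_ isT).
have := @tail_ge0 tau2.+1 isT; have := @tail_ge0 tau1.+1 isT.
move: (\sum_(_ <= _ < _) _) (\sum_(_ <= _ < _) _) => s1 s2.
have a12 := sorted tau1_gt0 (ltnW tau12) tau2n.
have a20 : 0 <= lam tau2 by rewrite spectrum_ge0// tau2_gt0.
(* Beyond [tau1] the eigenvalue of B_tau1 is a + S, a common factor of both sides; it remains to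
   compare b with [lam (minn i.+1 tau2)]. *)
have [i1|i1] := leqP i.+1 tau1; last first.
  have : lam tau2 <= lam (minn i.+1 tau2).
    by apply: sorted; rewrite ?leq_min ?tau2_gt0// geq_minr.
  nra.
rewrite (minn_idPl _) ?(leq_trans i1 (ltnW tau12))//.
(* With l = [lam i.+1], the right side minus the left is l(a - b) + S(l - b) - T(l - a), which is
   nonnegative as l >= a >= b >= 0 and S >= T >= 0. *)
have := sorted (isT : (1 <= i.+1)%N) i1 tau1n.
nra.
Qed.

End SpectrumComparison.

Theorem mainTheorem3 (R : realType) (n : nat)
    (B Q : 'M[R]_n) (lam : nat -> R) (f : 'rV[R]_n -> R) (x0 : 'rV[R]_n) :
  is_psd B ->
  is_sorted_spectral_decomp B Q lam ->
  convex_function [set: 'rV[R]_n] f ->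
  one_smooth B f ->
  bounded_set (sublevel f x0) ->
  exists D : nat -> R,
    (forall tau : nat, (1 <= tau <= \rank B)%N ->
       is_maxmin (sublevel f x0) (Argmin f)
         (fun x xs => seminorm (coord_approx Q lam tau) (x - xs)) (D tau)) /\
    (forall tau1 tau2 : nat,
       (1 <= tau1)%N -> (tau1 < tau2)%N -> (tau2 <= \rank B)%N ->
       D tau2 ^+ 2 <= D tau1 ^+ 2 /\
       D tau1 ^+ 2 <= tail_ratio n lam tau1 tau2 * D tau2 ^+ 2).
Proof.
move=> psdB specB _ [df _] bf.
have cf : continuous f by move=> x; exact: differentiable_continuous.
(* The seminorm of any matrix is continuous, so a max-min value exists for every [tau]; choice
   collects these into one function. *)
have [D DP] : {D : nat -> R & forall tau, is_maxmin (sublevel f x0) (Argmin f)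
    (fun x xs => seminorm (coord_approx Q lam tau) (x - xs)) (D tau)}.
  apply: (@choice _ _ (fun tau => is_maxmin _ _
    (fun x xs => seminorm (coord_approx Q lam tau) (x - xs)))) => tau.
  apply: maxmin_exists.
  - exact: compact_sublevel.
  - by exists x0; rewrite /sublevel /=.
  - exact: compact_Argmin bf.
  - exact: Argmin_neq0 bf.
  - move=> x y; apply: (@continuous_comp _ _ _ (fun y => x - y)
      (seminorm _)); last exact: continuous_seminorm.
    by apply: continuousB => [|z]; [exact: cst_continuous|exact].
  - move=> y x; apply: (@continuous_comp _ _ _ (fun x => x - y)
      (seminorm _)); last exact: continuous_seminorm.
    by apply: continuousB => [z|]; [exact|exact: cst_continuous].
exists D; split=> // tau1 tau2 t1 t12 t2B.
have [QQ _ _] := specB.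
have t2 := leq_trans t1 (ltnW t12).
have D0 tau : 0 <= D tau.
  by apply: maxmin_ge0 (DP tau) => x y; exact: sqrtr_ge0.
split.
  rewrite ler_sqr ?nnegrE//.
  (* The factor 1 is inserted to be read as [Num.sqrt 1], the constant in the seminorm
     comparison. *)
  rewrite -[leRHS]mul1r; apply: le_maxmin (DP tau2) (DP tau1) => // x y.
  rewrite !coord_approxE// -sqrtr1; apply: le_seminorm_spectral => // i.
    exact: (approx_spectrum_ge0 psdB specB i t1).
  by rewrite mul1r; exact: (le_approx_spectrum psdB specB t1 t12 t2B).
have r0 := tail_ratio_ge0 psdB specB t1 t12 t2B.
(* Writing the ratio as the square of its root reduces the claim to unsquared radii. *)
rewrite -[X in X * _](sqr_sqrtr r0) -exprMn ler_sqr ?nnegrE ?mulr_ge0 ?sqrtr_ge0//.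
apply: le_maxmin (DP tau1) (DP tau2); first exact: sqrtr_ge0.
move=> x y; rewrite !coord_approxE//; apply: le_seminorm_spectral => // i.
  exact: (approx_spectrum_ge0 psdB specB i t2).
exact: (approx_spectrum_le_ratio psdB specB t1 t12 t2B i).
Qed.
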